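(* Let $\mathcal I=\{I\subseteq\{1,\dots,n\}\mid \text{the induced subdiagram on }\{\alpha_i\mid i\in I\}\cup\{-\lambda\}\text{ of the extended Dynkin diagram is connected}\}$, and let $J=\{j\in\{1,\dots,n\}\mid(\lambda,\alpha_j)=0\}$ be the type of $\lambda$. For $I\in\mathcal I$ let $I^*=I\cup\{j\in J\mid(\alpha_j,\alpha_i)=0\text{ for all } i\in I\}$. Then the $f$-polynomial of $\mathbf P$ is $$\sum_{I\in\mathcal I}\frac{|W|}{|W_{I^*}|}\,t^{|I|}.$$
   Context: Let $\mathfrak g$ be a finite-dimensional complex simple Lie algebra with root system $\Phi$, base $\Pi=\{\alpha_1,\dots,\alpha_n\}$, Weyl group $W$; $E$ is the real span of $\Pi$ with $W$-invariant inner product $(\cdot,\cdot)$. Let $\lambda$ be a dominant integral weight and $\mathbf P=\mathrm{conv}(W\lambda)$ its weight polytope. For $K\subseteq\{1,\dots,n\}$, $W_K$ is the subgroup of $W$ generated by $s_{\alpha_k}$, $k\in K$. The extended Dynkin diagram is the Dynkin diagram of $\Pi$ with an extra node $\{-\lambda\}$ joined by a single edge to $\alpha_i$ iff $(\lambda,\alpha_i)>0$. The $f$-polynomial of $\mathbf P$ is $\sum_{k\ge0}f_k t^k$ where $f_k$ is the number of $k$-dimensional faces of $\mathbf P$. *)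

(* Defs.v *)
From HB Require Import structures.
From mathcomp Require Import all_boot all_order all_algebra.
From mathcomp Require Import reals.
From Stdlib Require Import ClassicalEpsilon.
From Stdlib Require List.

Set Implicit Arguments.
Unset Strict Implicit.
Unset Printing Implicit Defensive.

Import Order.TTheory GRing.Theory Num.Theory.
Local Open Scope ring_scope.

(* Cardinality of a (finite) collection given by a predicate on any type:
   the length of a duplicate-free list enumerating exactly the collection
   (0 if there is no such list, i.e. if the collection is infinite). *)
Definition ncard {T : Type} (P : T -> Prop) : nat :=
  epsilon (inhabits 0%N)
    (fun k => exists l : list T,
       List.NoDup l /\ List.length l = k /\ forall x, List.In x l <-> P x).

Section RootSystems.
Context {R : realType} {n : nat}.
Local Notation vec := 'rV[R]_n.

Definition dot (u v : vec) : R := (u *m v^T) 0 0.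

Definition refl (a x : vec) : vec := x - (2 * dot x a / dot a a) *: a.
Definition reflmx (a : vec) : 'M[R]_n := lin1_mx (refl a).

Definition root_system (Phi : seq vec) : Prop :=
  [/\ (forall a, a \in Phi -> a != 0),
      (forall a (c : R), a \in Phi -> c *: a \in Phi -> c = 1 \/ c = -1),
      (forall a b, a \in Phi -> b \in Phi -> refl a b \in Phi),
      (forall a b, a \in Phi -> b \in Phi -> 2 * dot b a / dot a a \is a Num.int) &
      (forall x : vec, x \in <<Phi>>%VS)].

Definition irreducible (Phi : seq vec) : Prop :=
  Phi != [::] /\
  forall S : vec -> bool,
    (forall a b, a \in Phi -> b \in Phi -> S a -> ~~ S b -> dot a b = 0) ->
    all S Phi \/ all (fun a => ~~ S a) Phi.

Definition is_base (Phi : seq vec) (alpha : 'I_n -> vec) : Prop :=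
  [/\ (forall i, alpha i \in Phi),
      free [seq alpha i | i <- enum 'I_n] &
      (forall b, b \in Phi -> exists c : 'I_n -> int,
          b = \sum_i (c i)%:~R *: alpha i /\
          ((forall i, 0 <= c i) \/ (forall i, c i <= 0)))].

Definition dominant_integral (alpha : 'I_n -> vec) (lam : vec) : Prop :=
  forall i, 2 * dot lam (alpha i) / dot (alpha i) (alpha i) \is a Num.nat.

(* Submonoid (= subgroup, generators being involutions) of matrices
   generated by a finite list of matrices. *)
Inductive gen_by (gens : seq 'M[R]_n) : 'M[R]_n -> Prop :=
| gen_one : gen_by gens 1%:M
| gen_mul g x : g \in gens -> gen_by gens x -> gen_by gens (g *m x).

Definition weyl (Phi : seq vec) : 'M[R]_n -> Prop := gen_by (map reflmx Phi).

Definition parabolic (alpha : 'I_n -> vec) (K : {set 'I_n}) : 'M[R]_n -> Prop :=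
  gen_by [seq reflmx (alpha k) | k <- enum K].

Definition Worbit (Phi : seq vec) (lam : vec) : vec -> Prop :=
  fun x => exists w, weyl Phi w /\ x = lam *m w.

Definition conv (S : vec -> Prop) : vec -> Prop :=
  fun x => exists l : seq (R * vec),
    [/\ (forall p, p \in l -> 0 <= p.1 /\ S p.2),
        \sum_(p <- l) p.1 = 1 &
        x = \sum_(p <- l) p.1 *: p.2].

(* Faces of a convex set P: intersections with supporting hyperplanes
   (including P itself, via a = 0, b = 0; the empty face is excluded
   below by the dimension requirement). *)
Definition face (P F : vec -> Prop) : Prop :=
  exists (a : vec) (b : R),
    (forall y, P y -> dot a y <= b) /\ (forall x, F x <-> (P x /\ dot a x = b)).

Definition affdim (F : vec -> Prop) (k : nat) : Prop :=
  (exists x0 (s : seq vec), [/\ F x0, (forall x, x \in s -> F x), size s = k &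
                                 free [seq x - x0 | x <- s]]) /\
  (forall x0 (s : seq vec), F x0 -> (forall x, x \in s -> F x) ->
      free [seq x - x0 | x <- s] -> (size s <= k)%N).

Definition fcount (P : vec -> Prop) (k : nat) : nat :=
  ncard (fun F : vec -> Prop => face P F /\ affdim F k).

(* Extended Dynkin diagram: nodes Some i = alpha_i, None = -lam. *)
Definition ext_adj (alpha : 'I_n -> vec) (lam : vec) : rel (option 'I_n) :=
  fun x y =>
    match x, y with
    | Some i, Some j => (i != j) && (dot (alpha i) (alpha j) != 0)
    | None, Some j => 0 < dot lam (alpha j)
    | Some i, None => 0 < dot lam (alpha i)
    | None, None => false
    end.

Definition ext_connected (alpha : 'I_n -> vec) (lam : vec) (I : {set 'I_n}) : bool :=
  let S := None |: [set Some i | i in I] in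
  [forall x in S,
     connect (fun u v => [&& u \in S, v \in S & ext_adj alpha lam u v]) None x].

Definition typeJ (alpha : 'I_n -> vec) (lam : vec) : {set 'I_n} :=
  [set j | dot lam (alpha j) == 0].

Definition Istar (alpha : 'I_n -> vec) (lam : vec) (I : {set 'I_n}) : {set 'I_n} :=
  I :|: [set j in typeJ alpha lam | [forall i in I, dot (alpha j) (alpha i) == 0]].

End RootSystems.

(* Main.v *)
(* Write [Z a] for the set of simple roots orthogonal to a dominant [a]. If
   [w lam] maximizes [dot a] over the orbit [W lam], then moving [w lam] to a
   [Z a]-dominant element of its [W_(Z a)]-orbit gives [lam] itself, so the face
   exposed by [a] is the convex hull of [W_(Z a) lam]; since the roots of [Z a]
   not linked to [-lam] fix this orbit pointwise, it equals [W_I lam] with [I]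
   the connected component of [-lam]. For connected [I], the sum [p_I] of the
   points of [W_I lam] is dominant, its orthogonal simple roots form [I* ], and
   the support of [|W_I lam| lam - p_I] on the base is exactly [I]. Hence faces
   correspond bijectively to pairs of a connected [I] and a point of the orbit
   [W p_I], whose stabilizer is generated by the reflections in [I* ]. *)
Require Import Defs.
From HB Require Import structures.
From mathcomp Require Import all_boot all_order all_algebra.
From mathcomp Require Import reals boolp.
From mathcomp Require Import ring lra zify.
From Stdlib Require Import ClassicalEpsilon.
From Stdlib Require List.

Import Order.TTheory GRing.Theory Num.Theory.
Local Open Scope ring_scope.

Set Implicit Arguments.
Unset Strict Implicit.
Unset Printing Implicit Defensive.

(** * Counting finite collections by duplicate-free lists *)

Section Counting.

Lemma ncardE (T : Type) (P : T -> Prop) (l : list T) :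
  List.NoDup l -> (forall x, List.In x l <-> P x) -> ncard P = size l.
Proof.
move=> ul lP; rewrite /ncard.
have ex : exists k, exists l : list T,
  List.NoDup l /\ List.length l = k /\ forall x, List.In x l <-> P x.
  by exists (List.length l), l.
have [l' [ul' [<- l'P]]] := epsilon_spec (inhabits 0%N) _ ex.
by apply: (PeanoNat.Nat.le_antisymm); apply: List.NoDup_incl_length => // x;
  rewrite /List.incl ?lP ?l'P.
Qed.

Lemma InP (T : eqType) (x : T) (l : seq T) : List.In x l <-> x \in l.
Proof.
elim: l => //= y l IH; rewrite inE; split.
  by case=> [->|/IH ->]; rewrite ?eqxx ?orbT.
by case/orP=> [/eqP ->|/IH]; [left|right].
Qed.

Lemma uniq_NoDup (T : eqType) (l : seq T) : uniq l -> List.NoDup l.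
Proof.
elim: l => /= [_|x l IH /andP[xl /IH ul]]; first exact: List.NoDup_nil.
by apply: List.NoDup_cons => // /InP; rewrite (negbTE xl).
Qed.

Lemma ncard_uniq (T : eqType) (P : T -> Prop) (l : seq T) :
  uniq l -> (forall x, x \in l <-> P x) -> ncard P = size l.
Proof.
by move=> ul lP; apply: ncardE; [exact: uniq_NoDup|move=> x; rewrite InP].
Qed.

Lemma NoDup_map_in (T : eqType) (U : Type) (f : T -> U) (l : seq T) :
  uniq l -> {in l &, injective f} -> List.NoDup (map f l).
Proof.
elim: l => /= [_ _|x l IH /andP[xl ul] finj]; first exact: List.NoDup_nil.
apply: List.NoDup_cons; last first.
  by apply: IH => // y z yl zl; apply: finj; rewrite inE ?yl ?zl orbT.
move=> /List.in_map_iff[y [fyx /InP yl]]; move: xl; rewrite -(finj y x) ?yl //.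
  by rewrite inE yl orbT.
by rewrite inE eqxx.
Qed.

(** An injection into a finite type leaves each code at most one preimage, which classical choice
    picks out. This is how the Weyl group is shown to be finite. *)
Lemma finite_enum (T : eqType) (U : finType) (P : T -> Prop) (f : T -> U) :
  (forall x y, P x -> P y -> f x = f y -> x = y) ->
  exists l : seq T, uniq l /\ forall x, x \in l <-> P x.
Proof.
move=> finj.
pose g u := if pselect (exists x, P x /\ f x = u) is left e
  then Some (sval (cid e)) else None.
exists (undup (pmap g (enum U))); split; first exact: undup_uniq.
move=> x; rewrite mem_undup mem_pmap; split.
  move=> /mapP[u _]; rewrite /g; case: pselect => // e [->].
  by case: (svalP (cid e)).
move=> Px; apply/mapP; exists (f x); first by rewrite mem_enum.
rewrite /g; case: pselect => [e|[]]; last by exists x.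
by case: (svalP (cid e)) => Py fy; congr Some; apply: finj.
Qed.

Lemma argmax (R : realType) (T : eqType) (r : seq T) (f : T -> R) : r != [::] ->
  exists2 m, m \in r & forall t, t \in r -> f t <= f m.
Proof.
elim: r => // z r IH _; have [->|/IH[m mr mmax]] := eqVneq r [::].
  by exists z => [|y]; rewrite inE // => /eqP ->.
have [fz|/ltW fz] := leP (f z) (f m).
  exists m; first by rewrite inE mr orbT.
  by move=> y; rewrite inE => /orP[/eqP->|/mmax].
exists z; first by rewrite inE eqxx.
by move=> y; rewrite inE => /orP[/eqP->//|/mmax ym]; apply: le_trans fz.
Qed.

End Counting.

(** * Inner product and orthogonal reflections *)

Section Geometry.
Context {R : realType} {n : nat}.
Local Notation vec := 'rV[R]_n.
Implicit Types (u v x y a b : vec) (w g : 'M[R]_n).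

Lemma dotE u v : dot u v = \sum_i u 0 i * v 0 i.
Proof. by rewrite /dot mxE; apply: eq_bigr => i _; rewrite mxE. Qed.

Lemma dotC u v : dot u v = dot v u.
Proof. by rewrite !dotE; apply: eq_bigr => i _; rewrite mulrC. Qed.

Lemma dotDl u v x : dot (u + v) x = dot u x + dot v x.
Proof. by rewrite /dot mulmxDl mxE. Qed.

Lemma dotZl c u x : dot (c *: u) x = c * dot u x.
Proof. by rewrite /dot -scalemxAl mxE. Qed.

Lemma dotNl u x : dot (- u) x = - dot u x.
Proof. by rewrite /dot mulNmx mxE. Qed.

Lemma dotBl u v x : dot (u - v) x = dot u x - dot v x.
Proof. by rewrite dotDl dotNl. Qed.

Lemma dot0l x : dot 0 x = 0.
Proof. by rewrite /dot mul0mx mxE. Qed.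

Lemma dot_suml (I : Type) (r : seq I) (P : pred I) (F : I -> vec) x :
  dot (\sum_(i <- r | P i) F i) x = \sum_(i <- r | P i) dot (F i) x.
Proof. by rewrite /dot mulmx_suml summxE. Qed.

Lemma dotDr u v x : dot x (u + v) = dot x u + dot x v.
Proof. by rewrite dotC dotDl !(dotC x). Qed.

Lemma dotZr c u x : dot x (c *: u) = c * dot x u.
Proof. by rewrite dotC dotZl (dotC x). Qed.

Lemma dotNr u x : dot x (- u) = - dot x u.
Proof. by rewrite dotC dotNl (dotC x). Qed.

Lemma dotBr u v x : dot x (u - v) = dot x u - dot x v.
Proof. by rewrite dotDr dotNr. Qed.

Lemma dot_sumr (I : Type) (r : seq I) (P : pred I) (F : I -> vec) x :
  dot x (\sum_(i <- r | P i) F i) = \sum_(i <- r | P i) dot x (F i).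
Proof. by rewrite dotC dot_suml; apply: eq_bigr => i _; rewrite dotC. Qed.

Lemma dot_ge0 x : 0 <= dot x x.
Proof. by rewrite dotE sumr_ge0 // => i _; rewrite -expr2 sqr_ge0. Qed.

Lemma dot_eq0 x : (dot x x == 0) = (x == 0).
Proof.
apply/eqP/eqP => [|->]; last by rewrite dot0l.
rewrite dotE => /eqP; rewrite psumr_eq0; last first.
  by move=> i _; rewrite -expr2 sqr_ge0.
move=> /allP x0; apply/rowP => i; rewrite mxE.
by have := x0 i; rewrite mem_index_enum mulf_eq0 orbb => /(_ isT)/eqP.
Qed.

Lemma dot_gt0 x : x != 0 -> 0 < dot x x.
Proof. by move=> x0; rewrite lt_def dot_eq0 x0 dot_ge0. Qed.

Lemma dot_mul x y w : dot (x *m w) y = dot x (y *m w^T).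
Proof. by rewrite /dot trmx_mul trmxK mulmxA. Qed.

Lemma refl_linear a : linear (refl a).
Proof.
move=> c x y; apply/rowP => i; rewrite /refl dotDl dotZl !mxE; ring.
Qed.

HB.instance Definition _ a :=
  GRing.isLinear.Build R vec vec *:%R (refl a) (refl_linear a).

Lemma mul_reflmx a x : x *m reflmx a = refl a x.
Proof. exact: mul_rV_lin1. Qed.

Lemma mx_eqP w g : (forall x, x *m w = x *m g) -> w = g.
Proof. by move=> wg; apply/row_matrixP => i; rewrite !rowE wg. Qed.

Lemma dot_refl a x y : dot (refl a x) y = dot x (refl a y).
Proof. rewrite /refl dotBl dotBr dotZl dotZr (dotC y a); ring. Qed.

Lemma trmx_reflmx a : (reflmx a)^T = reflmx a.
Proof.
apply: mx_eqP => x; apply/eqP; rewrite -subr_eq0 -dot_eq0; set z := _ - _.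
by rewrite {1}/z dotBl dot_mul trmxK !mul_reflmx dot_refl subrr.
Qed.

Lemma refl_root a : a != 0 -> refl a a = - a.
Proof.
move=> /dot_gt0/lt0r_neq0 a0.
rewrite /refl mulfK // scaler_nat mulr2n; apply/rowP => i; rewrite !mxE; ring.
Qed.

Lemma reflK a x : a != 0 -> refl a (refl a x) = x.
Proof.
move=> a0; have /lt0r_neq0 aa := dot_gt0 a0.
rewrite {1}/refl dot_refl refl_root // dotNr mulrN mulNr scaleNr opprK.
by rewrite /refl subrK.
Qed.

Lemma reflmxK a : a != 0 -> reflmx a *m reflmx a = 1%:M.
Proof.
by move=> a0; apply: mx_eqP => x; rewrite mulmxA !mul_reflmx reflK // mulmx1.
Qed.

Lemma refl_orth a x : dot x a = 0 -> refl a x = x.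
Proof. by rewrite /refl => ->; rewrite mulr0 mul0r scale0r subr0. Qed.

Lemma reflN a x : refl (- a) x = refl a x.
Proof. by rewrite /refl !dotNr dotNl opprK mulrN mulNr scaleNr scalerN opprK. Qed.

Lemma reflmx_conj a w : w *m w^T = 1%:M ->
  reflmx a *m w = w *m reflmx (a *m w).
Proof.
move=> ww; apply: mx_eqP => x; rewrite !mulmxA !mul_reflmx /refl.
by rewrite !dot_mul -!mulmxA ww !mulmx1 mulmxBl -scalemxAl.
Qed.

(** * Submonoids generated by a list of matrices *)

Section Generation.
Variable gens : seq 'M[R]_n.

Lemma gen_by_in g : g \in gens -> gen_by gens g.
Proof. by move=> gg; rewrite -[g]mulmx1; apply: gen_mul => //; apply: gen_one. Qed.

Lemma gen_by_mul w g : gen_by gens w -> gen_by gens g -> gen_by gens (w *m g).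
Proof.
elim=> [|h x hg _ IH] gg; first by rewrite mul1mx.
by rewrite -mulmxA; apply: gen_mul => //; apply: IH.
Qed.

(** For reflection groups the transpose is the inverse, so this supplies closure under inverses,
    while [gen_by] only builds a monoid. *)
Lemma gen_by_tr : (forall g, g \in gens -> g^T = g) ->
  forall w, gen_by gens w -> gen_by gens w^T.
Proof.
move=> sym w; elim=> [|h x hg _ IH]; first by rewrite trmx1; apply: gen_one.
by rewrite trmx_mul (sym h) //; apply: gen_by_mul => //; apply: gen_by_in.
Qed.

Lemma gen_by_orth : (forall g, g \in gens -> g *m g^T = 1%:M) ->
  forall w, gen_by gens w -> w *m w^T = 1%:M.
Proof.
move=> orth w; elim=> [|h x hg _ IH]; first by rewrite trmx1 mulmx1.
by rewrite trmx_mul mulmxA -(mulmxA h) IH mulmx1 orth.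
Qed.

Lemma gen_by_stable (S : vec -> Prop) :
  (forall g, g \in gens -> forall x, S x -> S (x *m g)) ->
  forall w, gen_by gens w -> forall x, S x -> S (x *m w).
Proof.
move=> stS w; elim=> [|h y hg _ IH] x Sx; first by rewrite mulmx1.
by rewrite mulmxA; apply: IH; apply: stS.
Qed.

End Generation.

Lemma gen_by_sub (s t : seq 'M[R]_n) :
  (forall g, g \in s -> gen_by t g) -> forall w, gen_by s w -> gen_by t w.
Proof.
move=> st w; elim=> [|h x hg _ IH]; first exact: gen_one.
by apply: gen_by_mul => //; apply: st.
Qed.

(** * Convex hulls *)

Lemma conv_in (S : vec -> Prop) x : S x -> conv S x.
Proof.
move=> Sx; exists [:: (1, x)]; rewrite !big_seq1 /= scale1r; split=> // p.
by rewrite inE => /eqP ->.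
Qed.

Lemma conv_mul (S T : vec -> Prop) w y :
  (forall x, S x -> T (x *m w)) -> conv S y -> conv T (y *m w).
Proof.
move=> ST [l [lS l1 ->]]; exists [seq (p.1, p.2 *m w) | p <- l]; split.
- by move=> p /mapP[q /lS[q0 qS] ->] /=; split=> //; apply: ST.
- by rewrite big_map.
by rewrite big_map mulmx_suml; apply: eq_bigr => p _; rewrite scalemxAl.
Qed.

Lemma conv_dot_le (S : vec -> Prop) a c y :
  (forall x, S x -> dot a x <= c) -> conv S y -> dot a y <= c.
Proof.
move=> Sc [l [lS l1 ->]]; rewrite dot_sumr -[c]mul1r -l1 mulr_suml.
rewrite !big_seq ler_sum // => p /lS[p0 pS]; rewrite dotZr ler_wpM2l //; exact: Sc.
Qed.

Lemma conv_dot_eq (S : vec -> Prop) a c y :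
  (forall x, S x -> dot a x = c) -> conv S y -> dot a y = c.
Proof.
move=> Sc cy; apply: le_anti; rewrite (conv_dot_le _ cy) => [|x /Sc -> //].
rewrite -lerN2 -dotNl; apply: conv_dot_le cy => x /Sc <-.
by rewrite dotNl.
Qed.

(** A convex combination reaching the upper bound [c] gives nonzero weight only to points that reach
    [c] themselves. *)
Lemma conv_face (S T : vec -> Prop) a c y : (forall x, S x -> dot a x <= c) ->
  (forall x, S x -> dot a x = c -> T x) -> conv S y -> c <= dot a y -> conv T y.
Proof.
move=> Sc ST [l [lS l1 yE]] cy; exists [seq p <- l | p.1 != 0]; split; last first.
- rewrite yE big_filter (bigID (fun p : R * vec => p.1 == 0)) /= big1 ?add0r //.
  by move=> p /eqP ->; rewrite scale0r.
- rewrite -l1 big_filter [RHS](bigID (fun p : R * vec => p.1 == 0)) /=.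
  by rewrite [X in _ = X + _]big1 ?add0r // => p /eqP.
move=> p; rewrite mem_filter => /andP[p0 pl]; have [p_ge0 pS] := lS p pl.
split=> //; apply: ST => //; have : \sum_(q <- l) q.1 * (c - dot a q.2) == 0.
  apply/eqP/le_anti/andP; split; last first.
    by rewrite big_seq sumr_ge0 // => q /lS[q0 qS]; rewrite mulr_ge0 // subr_ge0 Sc.
  under eq_bigr => q _ do rewrite mulrBr.
  rewrite sumrB -mulr_suml l1 mul1r subr_le0 (le_trans cy) // yE dot_sumr.
  by rewrite ler_sum // => q _; rewrite dotZr.
rewrite big_seq psumr_eq0 => [/allP/(_ p pl)|q /lS[q0 qS]]; last first.
  by rewrite mulr_ge0 // subr_ge0 Sc.
by rewrite pl mulf_eq0 (negbTE p0) subr_eq0 => /eqP ->.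
Qed.

(** * Spans and linear independence *)

Lemma span_mulmx (X : seq vec) w x :
  x \in <<X>>%VS -> x *m w \in <<[seq y *m w | y <- X]>>%VS.
Proof.
move=> /(@coord_span _ _ _ (in_tuple X)) ->; rewrite mulmx_suml.
apply: memv_suml => i _; rewrite -scalemxAl; apply/memvZ/memv_span.
by apply: map_f; apply: mem_nth.
Qed.

Lemma span_orth (X : seq vec) a x :
  {in X, forall y, dot y a = 0} -> x \in <<X>>%VS -> dot x a = 0.
Proof.
move=> Xa /(@coord_span _ _ _ (in_tuple X)) ->; rewrite dot_suml big1 // => i _.
by rewrite dotZl Xa ?mulr0 //; apply: mem_nth.
Qed.

Lemma free_dual (I : eqType) (f g : I -> vec) (r : seq I) :
  (forall i j, dot (f i) (g j) = (i == j)%:R) -> uniq r -> free [seq f i | i <- r].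
Proof.
move=> fg; elim: r => [|i r IH] /=; first by rewrite nil_free.
move=> /andP[ir /IH fr]; rewrite free_cons fr andbT; apply/negP.
move=> /(span_orth (a := g i)); rewrite fg eqxx => H.
suff /eqP : 1 = 0 :> R by rewrite oner_eq0.
apply: H => y /mapP[j jr ->]; rewrite fg; case: eqP => // ji.
by rewrite -ji jr in ir.
Qed.

(** A vector is kept exactly when it lies outside the span of those already kept. This will provide
    the affinely independent points of a face. *)
Lemma free_subseq (X : seq vec) :
  exists Y, [/\ {subset Y <= X}, free Y & (<<X>> <= <<Y>>)%VS].
Proof.
elim: X => [|x X [Y [YX fY XY]]]; first by exists [::]; rewrite nil_free; split.
have [xY|xY] := boolP (x \in <<Y>>%VS).
  exists Y; split=> //; first by move=> y /YX yX; rewrite inE yX orbT.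
  by apply/span_subvP => y; rewrite inE => /orP[/eqP->//|yX]; apply/(subvP XY)/memv_span.
exists (x :: Y); split.
- by move=> y; rewrite !inE => /orP[->//|/YX ->]; rewrite orbT.
- by rewrite free_cons xY.
rewrite !span_cons; exact: addvS.
Qed.

End Geometry.

(** * Simple roots, their dual basis and positivity *)

Section Roots.
Context {R : realType} {n : nat} (Phi : seq 'rV[R]_n) (alpha : 'I_n -> 'rV[R]_n).
Hypotheses (HPhi : root_system Phi) (Hbase : is_base Phi alpha).
Local Notation vec := 'rV[R]_n.
Implicit Types (x y a b : vec) (w : 'M[R]_n) (i j : 'I_n) (s : seq 'I_n).

(** The basis dual to the simple roots, that is the fundamental coweights: [dot x (omega i)] is the
    coefficient of [alpha i] in [x]. *)
Definition omega j : vec := (col j (invmx (\matrix_i alpha i)))^T.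

Lemma simple_unitmx : \matrix_i alpha i \in unitmx.
Proof.
rewrite -row_free_unit; apply: inj_row_free => v.
rewrite mulmx_sum_row => v0; apply/rowP => k; rewrite mxE.
case: Hbase => _ fr _; have {fr} : free (map_tuple alpha (ord_tuple n)) by [].
move/freeP => /(_ (v 0)); apply; rewrite -[RHS]v0; apply: eq_bigr => l _.
by rewrite -tnth_nth tnth_map tnth_ord_tuple rowK.
Qed.

Lemma dot_alpha_omega i j : dot (alpha i) (omega j) = (i == j)%:R.
Proof.
have /matrixP/(_ i j) := mulmxV simple_unitmx; rewrite !mxE => <-; rewrite dotE.
by apply: eq_bigr => k _; rewrite !mxE.
Qed.

Lemma dot_alpha_sum_omega i : dot (alpha i) (\sum_j omega j) = 1.
Proof.
rewrite dot_sumr (bigD1 i) //= big1 ?dot_alpha_omega ?eqxx ?addr0 // => j ji.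
by rewrite dot_alpha_omega eq_sym (negbTE ji).
Qed.

Lemma simple_decomp x : x = \sum_i dot x (omega i) *: alpha i.
Proof.
have [c ->] : exists c : vec, x = \sum_i c 0 i *: alpha i.
  exists (x *m invmx (\matrix_i alpha i)).
  under eq_bigr => i _ do rewrite -[alpha i](rowK alpha).
  by rewrite -mulmx_sum_row mulmxKV // simple_unitmx.
apply: eq_bigr => i _; congr (_ *: _); rewrite dot_suml (bigD1 i) //= big1.
  by rewrite dotZl dot_alpha_omega eqxx mulr1 addr0.
by move=> j ji; rewrite dotZl dot_alpha_omega (negbTE ji) mulr0.
Qed.

Lemma eq_omega x y : (forall i, dot x (omega i) = dot y (omega i)) -> x = y.
Proof.
by move=> xy; rewrite [x]simple_decomp [y]simple_decomp; apply: eq_bigr => i _; rewrite xy.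
Qed.

Definition nneg x := forall i, 0 <= dot x (omega i).
Definition dominant x := forall i, 0 <= dot x (alpha i).

Lemma nnegD x y : nneg x -> nneg y -> nneg (x + y).
Proof. by move=> x0 y0 i; rewrite dotDl addr_ge0. Qed.

Lemma nnegZ c x : 0 <= c -> nneg x -> nneg (c *: x).
Proof. by move=> c0 x0 i; rewrite dotZl mulr_ge0. Qed.

Lemma nneg0 : nneg 0.
Proof. by move=> i; rewrite dot0l. Qed.

Lemma nneg_anti x : nneg x -> nneg (- x) -> x = 0.
Proof.
move=> x0 x1; apply: eq_omega => i; rewrite dot0l; apply: le_anti.
by rewrite x0 andbT; have := x1 i; rewrite dotNl oppr_ge0.
Qed.

Lemma dot_nneg x y : dominant x -> nneg y -> 0 <= dot x y.
Proof.
move=> dx ny; rewrite [y]simple_decomp dot_sumr sumr_ge0 // => i _.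
by rewrite dotZr mulr_ge0.
Qed.

Lemma alpha_root i : alpha i \in Phi.
Proof. by case: Hbase. Qed.

Lemma root_neq0 a : a \in Phi -> a != 0.
Proof. by case: HPhi => + _ _ _ _; apply. Qed.

Lemma alpha_neq0 i : alpha i != 0.
Proof. exact/root_neq0/alpha_root. Qed.

Lemma alpha_nneg i : nneg (alpha i).
Proof. by move=> j; rewrite dot_alpha_omega ler0n. Qed.

Lemma root_refl a b : a \in Phi -> b \in Phi -> refl a b \in Phi.
Proof. by case: HPhi => _ _ + _ _; apply. Qed.

Lemma root_opp a : a \in Phi -> - a \in Phi.
Proof. by move=> aP; rewrite -refl_root ?root_neq0 // root_refl. Qed.

Lemma root_sign b : b \in Phi -> nneg b \/ nneg (- b).
Proof.
case: Hbase => _ _ /[apply] -[c [-> sgn]].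
have ci i : dot (\sum_j (c j)%:~R *: alpha j) (omega i) = (c i)%:~R.
  rewrite dot_suml (bigD1 i) //= big1 ?dotZl ?dot_alpha_omega ?eqxx ?mulr1 ?addr0 //.
  by move=> j ji; rewrite dotZl dot_alpha_omega (negbTE ji) mulr0.
case: sgn => sgn; [left|right] => i; rewrite ?dotNl ci ?oppr_ge0.
  by rewrite ler0z.
by rewrite lerz0.
Qed.

Lemma root_simple i b : b \in Phi -> nneg b ->
  (forall j, j != i -> dot b (omega j) = 0) -> b = alpha i.
Proof.
move=> bP nb b0; have bE : b = dot b (omega i) *: alpha i.
  rewrite {1}[b]simple_decomp (bigD1 i) //= big1 ?addr0 // => j ji.
  by rewrite b0 // scale0r.
case: HPhi => _ red _ _ _; move: (red (alpha i) (dot b (omega i))).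
rewrite -bE => /(_ (alpha_root i) bP) [c1|c1]; first by rewrite bE c1 scale1r.
by have := nb i; rewrite c1 ler0N1.
Qed.

Lemma dot_refl_omega i j b : j != i ->
  dot (refl (alpha i) b) (omega j) = dot b (omega j).
Proof.
by move=> ji; rewrite /refl dotBl dotZl dot_alpha_omega eq_sym (negbTE ji) mulr0 subr0.
Qed.

(** The reflection changes only the coefficient of [alpha i]. A root has a single sign, so a
    negative image would leave [b] with no other coefficient, making it [alpha i]. *)
Lemma simple_refl_nneg i b : b \in Phi -> nneg b -> b <> alpha i ->
  nneg (refl (alpha i) b).
Proof.
move=> bP nb bi; have rP := root_refl (alpha_root i) bP.
case: (root_sign rP) => // neg; case: bi; apply: root_simple => // j ji.
apply: le_anti; rewrite nb andbT -(dot_refl_omega b ji).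
by have := neg j; rewrite dotNl oppr_ge0.
Qed.

(** Reflecting [alpha i] in [alpha j] gives a root with coefficient 1 at [alpha i], hence a positive
    one; its coefficient at [alpha j] is a negative multiple of [dot (alpha i) (alpha j)]. *)
Lemma dot_alpha_le0 i j : i != j -> dot (alpha i) (alpha j) <= 0.
Proof.
move=> ij; have rP := root_refl (alpha_root j) (alpha_root i).
have [|neg] := root_sign rP; last first.
  have := neg i; rewrite dotNl dot_refl_omega // dot_alpha_omega eqxx.
  by rewrite oppr_ge0 ler10.
move=> /(_ j); rewrite /refl dotBl dotZl !dot_alpha_omega eqxx (negbTE ij).
rewrite mulr1 sub0r oppr_ge0 pmulr_lle0 ?invr_gt0 ?dot_gt0 ?alpha_neq0 //.
by rewrite pmulr_rle0.
Qed.

(** * Words in simple reflections and dominant vectors *)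

Definition wd s : 'M[R]_n := foldr (fun i w => reflmx (alpha i) *m w) 1%:M s.

Lemma wd_cat s t : wd (s ++ t) = wd s *m wd t.
Proof. by elim: s => /= [|i s IH]; rewrite ?mul1mx // IH mulmxA. Qed.

Lemma wd_rcons s i : wd (rcons s i) = wd s *m reflmx (alpha i).
Proof. by rewrite -cats1 wd_cat /= mulmx1. Qed.

Lemma weyl_orth w : weyl Phi w -> w *m w^T = 1%:M.
Proof.
apply: gen_by_orth => g /mapP[a aP ->].
by rewrite trmx_reflmx reflmxK // root_neq0.
Qed.

Lemma weyl_orthC w : weyl Phi w -> w^T *m w = 1%:M.
Proof. by move=> /weyl_orth /mulmx1C. Qed.

Lemma weyl_tr w : weyl Phi w -> weyl Phi w^T.
Proof. by apply: gen_by_tr => g /mapP[a _ ->]; rewrite trmx_reflmx. Qed.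

Lemma weyl_root w b : weyl Phi w -> b \in Phi -> b *m w \in Phi.
Proof.
move=> Ww; apply: (@gen_by_stable _ _ _ (fun b => b \in Phi) _ _ Ww b).
by move=> g /mapP[a aP ->] x xP; rewrite mul_reflmx root_refl.
Qed.

Lemma dot_weyl w x y : weyl Phi w -> dot (x *m w) (y *m w) = dot x y.
Proof. by move=> Ww; rewrite dot_mul -mulmxA weyl_orth // mulmx1. Qed.

Lemma weyl_simple i : weyl Phi (reflmx (alpha i)).
Proof. by apply: gen_by_in; apply: map_f; apply: alpha_root. Qed.

Lemma weyl_wd s : weyl Phi (wd s).
Proof.
elim: s => [|i s IH] /=; first exact: gen_one.
by apply: gen_by_mul => //; apply: weyl_simple.
Qed.

(** The exchange principle. As the letters of [s] act in turn, the image of [alpha i] can become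
    negative only at a letter whose simple root it equals, and there two reflections cancel. *)
Lemma wd_shorten i s : nneg (alpha i *m wd s) \/
  exists2 s', (size s' <= size s)%N & wd (i :: s) = wd s'.
Proof.
elim/last_ind: s => [|s j IH]; first by left; rewrite /= mulmx1; apply: alpha_nneg.
case: IH => [nb|[s' s's e]]; last first.
  by right; exists (rcons s' j); rewrite ?size_rcons // -rcons_cons !wd_rcons e.
have bP : alpha i *m wd s \in Phi by apply: weyl_root (weyl_wd s) (alpha_root i).
have [bj|/eqP bj] := eqVneq (alpha i *m wd s) (alpha j); last first.
  by left; rewrite wd_rcons mulmxA mul_reflmx; apply: simple_refl_nneg.
right; exists s; first by rewrite size_rcons.
rewrite -rcons_cons wd_rcons /= reflmx_conj; last exact/weyl_orth/weyl_wd.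
by rewrite bj -mulmxA reflmxK ?alpha_neq0 // mulmx1.
Qed.

Definition fixset x : {set 'I_n} := [set i | dot x (alpha i) == 0].

Lemma parabolic_simple (K : {set 'I_n}) i : i \in K -> parabolic alpha K (reflmx (alpha i)).
Proof. by move=> iK; apply/gen_by_in/map_f; rewrite mem_enum. Qed.

Lemma parabolic_weyl (K : {set 'I_n}) w : parabolic alpha K w -> weyl Phi w.
Proof. by apply: gen_by_sub => g /mapP[i _ ->]; apply: weyl_simple. Qed.

Lemma parabolic_tr (K : {set 'I_n}) w : parabolic alpha K w -> parabolic alpha K w^T.
Proof. by apply: gen_by_tr => g /mapP[a _ ->]; rewrite trmx_reflmx. Qed.

Lemma parabolic_fix (K : {set 'I_n}) x w : {in K, forall k, dot x (alpha k) = 0} ->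
  parabolic alpha K w -> x *m w = x.
Proof.
move=> xK; elim=> [|g v /mapP[i + ->] _ IH]; first by rewrite mulmx1.
by rewrite mem_enum => iK; rewrite mulmxA mul_reflmx refl_orth ?xK.
Qed.

(** Induction on the length of the word. The difference for [i :: s] is a nonnegative multiple of
    [alpha i *m wd s] plus the difference for [s]. Unless the word can be shortened, both are
    nonnegative, and if their sum vanishes then the first letter fixes [x]. *)
Lemma dominant_wd x s : dominant x ->
  nneg (x - x *m wd s) /\ (x *m wd s = x -> parabolic alpha (fixset x) (wd s)).
Proof.
move=> dx; have [k] := ubnP (size s); elim: k s => // k IH [|i s] /=.
  by move=> _; rewrite mulmx1 subrr; split=> [|_]; [apply: nneg0|apply: gen_one].
rewrite ltnS => sk; case: (wd_shorten i s) => [ni|[s' s's /= ->]]; last first.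
  by apply: IH; apply: leq_ltn_trans s's sk.
have [n1 fix1] := IH s sk; set c := 2 * dot x (alpha i) / dot (alpha i) (alpha i).
have c0 : 0 <= c by rewrite !mulr_ge0 ?invr_ge0 ?dot_ge0.
have e : x - x *m (reflmx (alpha i) *m wd s) =
    c *: (alpha i *m wd s) + (x - x *m wd s).
  rewrite mulmxA mul_reflmx /refl -/c mulmxBl -scalemxAl.
  by rewrite opprB addrCA.
rewrite e; split; first by apply: nnegD => //; apply: nnegZ.
move=> xs; move: e; rewrite xs subrr => /esym/eqP.
rewrite addr_eq0 => /eqP e.
have ci : c *: (alpha i *m wd s) = 0.
  by apply: nneg_anti; [apply: nnegZ|rewrite e opprK].
have xi : dot x (alpha i) = 0.
  move/eqP: ci; rewrite scaler_eq0 (negbTE (root_neq0 _)) ?orbF; last first.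
    by apply: weyl_root (weyl_wd s) (alpha_root i).
  by rewrite !mulf_eq0 invr_eq0 dot_eq0 (negbTE (alpha_neq0 i)) pnatr_eq0 orbF => /eqP.
apply: gen_by_mul; first by apply: parabolic_simple; rewrite inE xi.
apply: fix1; move: xs; rewrite mulmxA mul_reflmx refl_orth //.
Qed.

(* Among the positive roots conjugate to [b] under simple reflections, one of
   minimal height has to be simple. *)
Lemma root_conj_simple b : b \in Phi -> nneg b -> exists s i, alpha i = b *m wd s.
Proof.
move=> bP nb; pose ht x := dot x (\sum_i omega i).
pose C := [seq x <- Phi | `[< nneg x /\ exists s, x = b *m wd s >]].
have memC x : x \in C <-> [/\ x \in Phi, nneg x & exists s, x = b *m wd s].
  rewrite mem_filter; split; first by case/andP => /asboolP[].
  by case=> xP nx e; rewrite xP andbT; apply/asboolP.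
have : C != [::].
  have : b \in C by apply/memC; split=> //; exists [::]; rewrite mulmx1.
  by case: C {memC}.
case/(argmax (fun x => - ht x)) => m /memC[mP nm [s ms]] mmin.
have [i mi] : exists i, 0 < dot m (alpha i).
  apply/existsP; rewrite -[X in is_true X]negbK negb_exists; apply/negP => /forallP mneg.
  have := dot_gt0 (root_neq0 mP); rewrite [X in dot m X]simple_decomp dot_sumr ltNge.
  rewrite -oppr_ge0 -sumrN sumr_ge0 // => i _.
  by rewrite dotZr -mulrN mulr_ge0 // oppr_ge0 leNgt.
have [mE|/eqP ma] := eqVneq m (alpha i); first by exists s, i; rewrite -mE.
have /mmin : refl (alpha i) m \in C.
  apply/memC; split; [exact: root_refl (alpha_root i) mP|exact: simple_refl_nneg|].
  by exists (rcons s i); rewrite wd_rcons mulmxA -ms mul_reflmx.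
rewrite lerN2 /ht /refl dotBl dotZl dot_alpha_sum_omega mulr1 lerBrDl.
rewrite gerDr leNgt divr_gt0 ?mulr_gt0 //.
by rewrite dot_gt0 // alpha_neq0.
Qed.

(** By [root_conj_simple] the reflection in a positive root is conjugate to a simple one, and
    opposite roots share their reflection. *)
Lemma weyl_wdE w : weyl Phi w -> exists s, w = wd s.
Proof.
have refl_wd a : a \in Phi -> nneg a -> exists s, reflmx a = wd s.
  move=> aP na; have [s [i e]] := root_conj_simple aP na.
  have [t te] : exists t, (wd s)^T = wd t.
    exists (rev s); elim: s {e} => [|j s IH] /=; first by rewrite trmx1.
    by rewrite trmx_mul trmx_reflmx IH rev_cons wd_rcons.
  exists (s ++ i :: t); rewrite wd_cat /= -te mulmxA e -reflmx_conj.
    by rewrite -mulmxA weyl_orth ?mulmx1 //; apply: weyl_wd.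
  exact/weyl_orth/weyl_wd.
elim=> [|g v /mapP[a aP ->] _ [s ->]]; first by exists [::].
have [t ->] : exists t, reflmx a = wd t.
  case: (root_sign aP) => na; first exact: refl_wd.
  have [t te] := refl_wd _ (root_opp aP) na; exists t; rewrite -te.
  by apply: mx_eqP => x; rewrite !mul_reflmx reflN.
by exists (t ++ s); rewrite wd_cat.
Qed.

(** An element of the Weyl group is determined by the positions in [Phi] of the images of the simple
    roots. *)
Lemma weyl_enum (P : 'M[R]_n -> Prop) : (forall w, P w -> weyl Phi w) ->
  exists l, uniq l /\ forall w, w \in l <-> P w.
Proof.
move=> PW.
(* [inord] requires a successor bound; the extra value, the index of a non-root, does not occur for
   matrices satisfying [P]. *)
pose f w := [ffun i => inord (index (alpha i *m w) Phi) : 'I_(size Phi).+1].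
apply: (@finite_enum _ _ P f) => w v Pw Pv /ffunP wv.
apply: mx_eqP => x; rewrite [x]simple_decomp !mulmx_suml; apply: eq_bigr => i _.
rewrite -!scalemxAl; congr (_ *: _).
have aw := weyl_root (PW _ Pw) (alpha_root i).
have av := weyl_root (PW _ Pv) (alpha_root i).
have := congr1 val (wv i); rewrite !ffunE /= !inordK ?ltnS ?index_size // => e.
by rewrite -(nth_index 0 aw) e nth_index.
Qed.

Lemma dominant_nneg x w : dominant x -> weyl Phi w -> nneg (x - x *m w).
Proof. by move=> dx /weyl_wdE[s ->]; case: (dominant_wd s dx). Qed.

Lemma dominant_stab x w : dominant x -> weyl Phi w ->
  x *m w = x <-> parabolic alpha (fixset x) w.
Proof.
move=> dx Ww; split.
  by have [s ->] := weyl_wdE Ww; case: (dominant_wd s dx).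
by apply: parabolic_fix => k; rewrite inE => /eqP.
Qed.

(** [dominant_nneg], applied to both vectors, bounds their difference from both sides. *)
Lemma dominant_unique x w : dominant x -> dominant (x *m w) -> weyl Phi w ->
  x *m w = x.
Proof.
move=> dx dxw Ww; apply/esym/subr0_eq; apply: nneg_anti.
  exact: dominant_nneg.
have := dominant_nneg dxw (weyl_tr Ww).
by rewrite -mulmxA weyl_orth // mulmx1 opprB.
Qed.

(** An element of the finite group [W_K] maximizing the height works: a negative pairing with
    [alpha k] would let its reflection raise the height further. *)
Lemma dominant_exists (K : {set 'I_n}) x :
  exists2 w, parabolic alpha K w & {in K, forall k, 0 <= dot (x *m w) (alpha k)}.
Proof.
have [l [_ lP]] := weyl_enum (@parabolic_weyl K).
have : l != [::].
  have : 1%:M \in l by apply/lP; apply: gen_one.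
  by case: l {lP}.
case/(argmax (fun w => dot (x *m w) (\sum_i omega i))) => w /lP Kw wmax.
exists w => // k kK; rewrite leNgt; apply/negP => neg.
have /lP/wmax : parabolic alpha K (w *m reflmx (alpha k)).
  by apply: gen_by_mul => //; apply: parabolic_simple.
rewrite mulmxA mul_reflmx /refl dotBl dotZl.
rewrite dot_alpha_sum_omega mulr1 lerBlDr lerDl leNgt pmulr_llt0 ?invr_gt0 ?dot_gt0 ?alpha_neq0 //.
by rewrite pmulr_rlt0 // neg.
Qed.

Lemma parabolic_dot (K : {set 'I_n}) a x w : {in K, forall k, dot a (alpha k) = 0} ->
  parabolic alpha K w -> dot a (x *m w) = dot a x.
Proof.
move=> aK Kw; rewrite -{1}(parabolic_fix aK Kw) dot_weyl //.
exact: parabolic_weyl Kw.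
Qed.

(* Move [x *m w] inside its [fixset a]-orbit to a [fixset a]-dominant [y];
   then [x - y] is a nonnegative combination of simple roots in [fixset a],
   so that [|x|^2 >= |y|^2 + |x - y|^2], whence [y = x]. *)
Lemma dominant_max_orbit a x w : dominant a -> dominant x -> weyl Phi w ->
  dot a (x *m w) = dot a x -> exists2 v, parabolic alpha (fixset a) v & x *m w = x *m v.
Proof.
move=> da dx Ww e; have aK : {in fixset a, forall k, dot a (alpha k) = 0}.
  by move=> k; rewrite inE => /eqP.
have [v Kv yd] := dominant_exists (fixset a) (x *m w).
have Wv := parabolic_weyl Kv.
have Wwv : weyl Phi (w *m v) by apply: gen_by_mul.
set y := x *m w *m v in yd; have yE : y = x *m (w *m v) by rewrite mulmxA.
have nxy : nneg (x - y) by rewrite yE; apply: dominant_nneg.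
have a0 : dot a (x - y) = 0 by rewrite dotBr (parabolic_dot _ aK Kv) e subrr.
have supp i : i \notin fixset a -> dot (x - y) (omega i) = 0.
  rewrite inE => ai; move/eqP: a0; rewrite [x - y]simple_decomp dot_sumr.
  rewrite psumr_eq0 => [/allP/(_ i)|j _]; last by rewrite dotZr mulr_ge0.
  rewrite mem_index_enum => /(_ isT); rewrite dotZr mulf_eq0 (negbTE ai) orbF.
  by rewrite -simple_decomp => /eqP.
have yxy : 0 <= dot y (x - y).
  rewrite [x - y]simple_decomp dot_sumr sumr_ge0 // => i _; rewrite dotZr.
  have [iK|iK] := boolP (i \in fixset a); last by rewrite supp // mul0r.
  by rewrite mulr_ge0 // yd.
have yy : dot y y = dot x x by rewrite yE dot_weyl.
have xy : x = y.
  apply/eqP; rewrite -subr_eq0 -dot_eq0; apply/eqP/le_anti; rewrite dot_ge0 andbT.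
  have : dot (x - y) (x - y) + 2 * dot y (x - y) = dot x x - dot y y.
    rewrite !(dotBl, dotBr) (dotC y x); ring.
  by rewrite yy subrr; lra.
exists v^T; first exact: parabolic_tr.
by rewrite {2}xy /y -[RHS]mulmxA weyl_orth // mulmx1.
Qed.

(** * Connectedness in the extended Dynkin diagram *)

Variable lam : vec.
Hypothesis lam_dom : dominant lam.
Implicit Types (I K : {set 'I_n}).

(** For [T] inside [K]: no edge of the extended diagram joins [T] to [-lam] or to the rest of [K],
    so [T] is a union of components avoiding [-lam]. *)
Definition detached (K T : {set 'I_n}) := forall t, t \in T ->
  dot lam (alpha t) = 0 /\ forall i, i \in K :\: T -> dot (alpha t) (alpha i) = 0.

(** The form in which connectedness is used below: to show that all of [I] has a property, one
    checks that the exceptions form a detached set. *)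
Lemma connected_detached (I T : {set 'I_n}) :
  ext_connected alpha lam I -> T \subset I -> detached I T -> T = set0.
Proof.
move=> /forall_inP conn /subsetP TI det; apply/setP => t; rewrite inE; apply/negP => tT.
set S := _ |: _ in conn.
have tS : Some t \in S by rewrite !inE /= imset_f // TI.
have SomeS i : Some i \in S -> i \in I.
  by rewrite !inE /= => /imsetP[j jI [->]].
(* The indicator of [T], false at [-lam], is constant along edges, so no path from [-lam] enters
   [T]. *)
pose a := [pred x : option 'I_n | if x is Some i then i \in T else false].
move: (conn _ tS); set e := (fun u v => _) => ct.
have cl : closed e a.
  move=> [i|] [j|] //= /and3P[].
  - move=> /SomeS iI /SomeS jI /andP[_ ij]; rewrite !unfold_in /=.
    have [iT|iT] := boolP (i \in T); have [jT|jT] := boolP (j \in T) => //.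
      have [_ o] := det i iT; case/eqP: ij; apply: o.
      by rewrite inE jT.
    have [_ o] := det j jT; case/eqP: ij; rewrite dotC; apply: o.
    by rewrite inE iT.
  - move=> _ _ li; rewrite !unfold_in /=; apply/negbTE/negP => /det[l0 _].
    by move: li; rewrite /= l0 ltxx.
  - move=> _ _ li; rewrite !unfold_in /=; apply/esym/negbTE/negP => /det[l0 _].
    by move: li; rewrite /= l0 ltxx.
by have : false = (t \in T) := closed_connect cl ct; rewrite tT.
Qed.

Lemma disconnected_detached (I : {set 'I_n}) : ~~ ext_connected alpha lam I ->
  exists T, [/\ T != set0, T \subset I & detached I T].
Proof.
rewrite /ext_connected; set S := _ |: _.
move=> /forall_inPn[[i|] xS]; last by rewrite connect0.
have SI j : (Some j \in S) = (j \in I).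
  by rewrite !inE /= mem_imset //; apply: Some_inj.
set e := (X in connect X) => nc; exists [set j in I | ~~ connect e None (Some j)]; split.
- by apply/set0Pn; exists i; rewrite inE -SI xS.
- by apply/subsetP => j; rewrite inE => /andP[].
move=> t; rewrite inE => /andP[tI nt]; split.
  apply/eqP/negPn/negP => lt; case/negP: nt; apply: connect1.
  rewrite /e SI tI /= !inE /= lt_def lt lam_dom //.
move=> j; rewrite !inE => /andP[+ jI]; rewrite jI negbK => cj.
have jt : j != t by apply: contraTneq cj => ->.
apply/eqP/negPn/negP => tj; case/negP: nt; apply: connect_trans cj (connect1 _).
by rewrite /e !SI tI jI /= dotC tj andbT.
Qed.

(** Detached sets are removed from [K] one at a time; each is orthogonal to [lam] and to everything
    that remains. *)
Lemma connected_core (K : {set 'I_n}) : exists I : {set 'I_n},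
  [/\ I \subset K, ext_connected alpha lam I &
      forall j, j \in K :\: I -> dot lam (alpha j) = 0 /\
        forall i, i \in I -> dot (alpha j) (alpha i) = 0].
Proof.
have [m] := ubnP #|K|; elim: m K => // m IH K Km.
have [cK|/disconnected_detached[T [T0 TK det]]] := boolP (ext_connected alpha lam K).
  by exists K; split=> // j; rewrite setDv inE.
case: (IH (K :\: T)) => [|I [IK cI orth]].
  by rewrite -card_gt0 in T0; rewrite cardsD (setIidPr TK); move: (subset_leq_card TK); lia.
exists I; split=> //; first by apply: subset_trans IK (subsetDl _ _).
move=> j; rewrite inE => /andP[jI jK].
have [jT|jT] := boolP (j \in T); last by apply: orth; rewrite !inE jI jT.
have [l0 o] := det j jT; split=> // i iI; apply: o; exact: (subsetP IK).
Qed.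

(** * Parabolic orbits of [lam] and their sums *)

Definition par_orbit (K : {set 'I_n}) x := exists w, parabolic alpha K w /\ x = lam *m w.

Lemma parabolic_sub (K L : {set 'I_n}) w : K \subset L ->
  parabolic alpha K w -> parabolic alpha L w.
Proof.
move=> /subsetP KL; apply: gen_by_sub => g /mapP[i + ->]; rewrite mem_enum => /KL.
exact: parabolic_simple.
Qed.

(** For [k] in [K] outside [I], [alpha k] is fixed by [W_I] and orthogonal to [lam], hence to all of
    [W_I lam]; its reflection therefore fixes that orbit pointwise. *)
Lemma par_orbit_core (I K : {set 'I_n}) : I \subset K ->
  (forall j, j \in K :\: I -> dot lam (alpha j) = 0 /\
        forall i, i \in I -> dot (alpha j) (alpha i) = 0) ->
  par_orbit K = par_orbit I.
Proof.
move=> IK orth; apply/funext => x; apply/propext; split; last first.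
  by case=> w [Iw ->]; exists w; split=> //; apply: parabolic_sub IK Iw.
case=> w [Kw ->]; apply: (gen_by_stable _ Kw); last first.
  by exists 1%:M; rewrite mulmx1; split=> //; apply: gen_one.
move=> g /mapP[k + ->] {}x [v [Iv ->]]; rewrite mem_enum => kK.
have [kI|kI] := boolP (k \in I).
  exists (v *m reflmx (alpha k)); rewrite mulmxA; split=> //.
  by apply: gen_by_mul => //; apply: parabolic_simple.
exists v; split=> //; have [|l0 o] := orth k; first by rewrite inE kI.
by rewrite mul_reflmx refl_orth // dotC (parabolic_dot _ _ Iv) // dotC.
Qed.

Definition wlist (K : {set 'I_n}) := sval (cid (weyl_enum (@parabolic_weyl K))).

Lemma wlist_uniq K : uniq (wlist K).
Proof. by rewrite /wlist; case: cid => l []. Qed.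

Lemma mem_wlist K w : w \in wlist K <-> parabolic alpha K w.
Proof. by rewrite /wlist; case: cid => l []. Qed.

Definition olist K := undup [seq lam *m w | w <- wlist K].

Lemma mem_olist K x : x \in olist K <-> par_orbit K x.
Proof.
rewrite mem_undup; split; first by case/mapP => w /mem_wlist; exists w.
by case=> w [/mem_wlist Kw ->]; apply: map_f.
Qed.

Lemma olist_lam K : lam \in olist K.
Proof. by apply/mem_olist; exists 1%:M; rewrite mulmx1; split=> //; apply: gen_one. Qed.

Lemma weyl_mulK w x : weyl Phi w -> x *m w *m w^T = x.
Proof. by move=> Ww; rewrite -mulmxA weyl_orth // mulmx1. Qed.

Lemma weyl_mulVK w x : weyl Phi w -> x *m w^T *m w = x.
Proof. by move=> Ww; rewrite -mulmxA weyl_orthC // mulmx1. Qed.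

Lemma weyl_inj w : weyl Phi w -> injective (fun x => x *m w).
Proof. by move=> Ww x y /(congr1 (fun z => z *m w^T)); rewrite !weyl_mulK. Qed.

Lemma olist_map K w : parabolic alpha K w -> perm_eq [seq x *m w | x <- olist K] (olist K).
Proof.
move=> Kw; have Ww := parabolic_weyl Kw; apply: uniq_perm; rewrite ?undup_uniq //.
  by rewrite map_inj_uniq ?undup_uniq //; apply: weyl_inj.
move=> x; apply/mapP/idP => [[y /mem_olist[v [Kv ->]] ->]|/mem_olist[v [Kv ->]]].
  by apply/mem_olist; exists (v *m w); rewrite mulmxA; split=> //; apply: gen_by_mul.
exists (lam *m (v *m w^T)); last by rewrite mulmxA weyl_mulVK.
by apply/mem_olist; exists (v *m w^T); split=> //; apply: gen_by_mul => //; apply: parabolic_tr.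
Qed.

(* The barycenter of the orbit of [lam], scaled by the size of the orbit. *)
Definition osum K : vec := \sum_(x <- olist K) x.

(** Equal to the sum of [lam - x] over the orbit, hence a nonnegative combination of the simple
    roots in [K]. For connected [K] all of them occur, so it remembers [K]. *)
Definition odefect K : vec := (size (olist K))%:R *: lam - osum K.

Lemma osum_parabolic K w : parabolic alpha K w -> osum K *m w = osum K.
Proof.
move=> Kw; rewrite /osum -[RHS](perm_big _ (olist_map Kw)) big_map mulmx_suml //.
Qed.

Lemma osum_orth K k : k \in K -> dot (osum K) (alpha k) = 0.
Proof.
move=> kK; have := osum_parabolic (parabolic_simple kK).
rewrite mul_reflmx /refl => /eqP; rewrite -subr_eq0 addrAC subrr sub0r oppr_eq0.
rewrite scaler_eq0 (negbTE (alpha_neq0 k)) orbF !mulf_eq0 invr_eq0 dot_eq0.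
by rewrite (negbTE (alpha_neq0 k)) pnatr_eq0 orbF => /eqP.
Qed.

Lemma odefectE K : odefect K = \sum_(x <- olist K) (lam - x).
Proof. by rewrite big_split /= sumrN big_const_seq count_predT iter_addr_0 -scaler_nat. Qed.

Lemma odefect_nneg K : nneg (odefect K).
Proof.
rewrite odefectE => i; rewrite dot_suml big_seq sumr_ge0 // => x.
by move=> /mem_olist[w [/parabolic_weyl Ww ->]]; apply: dominant_nneg.
Qed.

(** For [j] outside [K], [omega j] is orthogonal to the simple roots of [K], hence fixed by
    [W_K]. *)
Lemma par_orbit_omega K x j : par_orbit K x -> j \notin K ->
  dot x (omega j) = dot lam (omega j).
Proof.
case=> w [Kw ->] jK; rewrite !(dotC _ (omega j)) (parabolic_dot _ _ Kw) // => k kK.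
by rewrite dotC dot_alpha_omega; case: eqP jK kK => // -> /negbTE ->.
Qed.

Lemma odefect_supp K j : j \notin K -> dot (odefect K) (omega j) = 0.
Proof.
move=> jK; rewrite odefectE dot_suml big1_seq // => x /andP[_ /mem_olist xK].
by rewrite dotBl (par_orbit_omega xK jK) subrr.
Qed.

Lemma dot_osum K j : dot (osum K) (alpha j) =
  (size (olist K))%:R * dot lam (alpha j)
  + \sum_i dot (odefect K) (omega i) * - dot (alpha i) (alpha j).
Proof.
have -> : osum K = (size (olist K))%:R *: lam - odefect K.
  by rewrite /odefect opprB addrC subrK.
rewrite dotBl dotZl [X in _ - dot X _]simple_decomp dot_suml -sumrN.
by congr (_ + _); apply: eq_bigr => i _; rewrite dotZl mulrN.
Qed.

(** Distinct simple roots pair nonpositively, so only the term [i = j] could have the wrong sign,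
    and it vanishes under either alternative. *)
Lemma odefect_term_ge0 K i j : j \notin K \/ dot (odefect K) (omega j) = 0 ->
  0 <= dot (odefect K) (omega i) * - dot (alpha i) (alpha j).
Proof.
move=> jK; have {}jK : dot (odefect K) (omega j) = 0.
  by case: jK => // /odefect_supp.
have [->|ij] := eqVneq i j; first by rewrite jK mul0r.
by rewrite mulr_ge0 ?odefect_nneg // oppr_ge0 dot_alpha_le0.
Qed.

Lemma osum_dominant K : dominant (osum K).
Proof.
move=> j; have [jK|jK] := boolP (j \in K); first by rewrite osum_orth.
rewrite dot_osum addr_ge0 ?mulr_ge0 // sumr_ge0 // => i _.
by apply: odefect_term_ge0; left.
Qed.

Lemma olist_size_gt0 K : 0 < (size (olist K))%:R :> R.
Proof. by rewrite ltr0n; move: (olist_lam K); case: (olist K). Qed.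

(** A vanishing sum of nonnegative terms. The first alternative serves to find the simple roots
    orthogonal to [osum K], the second to show that [odefect] has full support. *)
Lemma dot_osum_eq0 K j : j \notin K \/ dot (odefect K) (omega j) = 0 ->
  dot (osum K) (alpha j) = 0 -> dot lam (alpha j) = 0 /\
    forall i, 0 < dot (odefect K) (omega i) -> dot (alpha j) (alpha i) = 0.
Proof.
move=> jK; rewrite dot_osum => /eqP; rewrite paddr_eq0; first last.
- by rewrite sumr_ge0 // => i _; apply: odefect_term_ge0.
- by rewrite mulr_ge0.
rewrite mulf_eq0 (gt_eqF (olist_size_gt0 K)) /= => /andP[/eqP -> ].
rewrite psumr_eq0 => [/allP s0|i _]; last exact: odefect_term_ge0.
split=> // i ipos; have := s0 i; rewrite mem_index_enum => /(_ isT).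
by rewrite /= mulf_eq0 (gt_eqF ipos) oppr_eq0 dotC => /eqP.
Qed.

Section Connected.
Variable I : {set 'I_n}.
Hypothesis connI : ext_connected alpha lam I.

(** By [dot_osum_eq0] the elements of [I] missing from the support would form a detached set. *)
Lemma odefect_gt0 i : (0 < dot (odefect I) (omega i)) = (i \in I).
Proof.
apply/idP/idP => [|iI]; first by apply: contraTT => /odefect_supp ->; rewrite ltxx.
rewrite lt_def odefect_nneg andbT; apply/eqP => i0.
pose T := [set j in I | dot (odefect I) (omega j) == 0].
suff /setP/(_ i) : T = set0 by rewrite !inE iI i0 eqxx.
apply: connected_detached connI _ _; first by apply/subsetP => j; rewrite inE => /andP[].
move=> t; rewrite inE => /andP[tI /eqP t0].
have [//||l0 o] := @dot_osum_eq0 I t; [by right|exact: osum_orth|].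
split=> // j; rewrite !inE => /andP[+ jI]; rewrite jI /= => j0.
by apply: o; rewrite lt_def j0 odefect_nneg.
Qed.

Lemma Istar_orth j : j \in Istar alpha lam I :\: I -> dot lam (alpha j) = 0 /\
        forall i, i \in I -> dot (alpha j) (alpha i) = 0.
Proof.
rewrite !inE => /andP[/negbTE -> /= /andP[/eqP -> /forall_inP o]].
by split=> // i /o/eqP.
Qed.

(** Outside [I], a simple root orthogonal to [osum I] is orthogonal to [lam] and to the support of
    [odefect I], which is all of [I] by connectedness. *)
Lemma fixset_osum : fixset (osum I) = Istar alpha lam I.
Proof.
apply/setP => j; rewrite !inE; have [jI|jI] /= := boolP (j \in I).
  by rewrite osum_orth ?eqxx.
apply/eqP/andP => [/dot_osum_eq0[|l0 o]|[/eqP l0 /forall_inP o]]; first by left.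
  by rewrite l0; split=> //; apply/forall_inP => i iI; rewrite o ?odefect_gt0.
rewrite dot_osum l0 mulr0 add0r big1 // => i _.
have [iI|iI] := boolP (i \in I); last by rewrite odefect_supp // mul0r.
by rewrite (dotC (alpha i)) (eqP (o i iI)) oppr0 mulr0.
Qed.

Lemma par_orbit_fixset : par_orbit (fixset (osum I)) = par_orbit I.
Proof.
rewrite fixset_osum; apply: par_orbit_core; first exact: subsetUl.
exact: Istar_orth.
Qed.

End Connected.

(** * Exposed faces of the weight polytope *)

Local Notation P := (conv (Worbit Phi lam)).

Lemma worbit_mul w x : weyl Phi w -> Worbit Phi lam x -> Worbit Phi lam (x *m w).
Proof.
move=> Ww [v [Wv ->]]; exists (v *m w); rewrite mulmxA; split=> //.
exact: gen_by_mul.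
Qed.

Lemma polytope_mul w y : weyl Phi w -> P y -> P (y *m w).
Proof. by move=> Ww; apply: conv_mul => x; apply: worbit_mul. Qed.

Lemma worbit_lam w : weyl Phi w -> Worbit Phi lam (lam *m w).
Proof. by exists w. Qed.

Lemma polytope_lam : P lam.
Proof. by apply: conv_in; exists 1%:M; rewrite mulmx1; split=> //; apply: gen_one. Qed.

Lemma worbit_dot_le a x : dominant a -> Worbit Phi lam x -> dot a x <= dot a lam.
Proof.
move=> da [w [Ww ->]]; rewrite -subr_ge0 -dotBr; apply: dot_nneg => //.
exact: dominant_nneg.
Qed.

Definition top a y := P y /\ forall z, P z -> dot a z <= dot a y.

(** On the orbit [W lam] the maximum of [dot a] is attained at [lam], and by [dominant_max_orbit]
    exactly on the orbit under [fixset a]; [conv_face] passes to the hull. *)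
Lemma top_dominant a : dominant a -> top a = conv (par_orbit (fixset a)).
Proof.
move=> da; apply/funext => y; apply/propext; split=> [[Py ymax]|cy].
  apply: conv_face Py (ymax _ polytope_lam); first by move=> x; apply: worbit_dot_le.
  by move=> x [w [Ww ->]] e; have [v av ->] := dominant_max_orbit da lam_dom Ww e; exists v.
have e : dot a y = dot a lam.
  apply: conv_dot_eq cy => x [w [aw ->]]; apply: parabolic_dot aw.
  by move=> k; rewrite inE => /eqP.
split=> [|z]; last by rewrite e; apply: conv_dot_le => x; apply: worbit_dot_le.
rewrite -[y]mulmx1; apply: conv_mul cy => x [w [aw ->]]; rewrite mulmx1.
exact/worbit_lam/parabolic_weyl/aw.
Qed.

Lemma top_mul a w y : weyl Phi w -> top (a *m w) y <-> top a (y *m w^T).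
Proof.
move=> Ww; have Ww' := weyl_tr Ww; split=> -[Py ymax]; split.
- exact: polytope_mul.
- by move=> z /(polytope_mul Ww)/ymax; rewrite dot_weyl // dot_mul.
- by rewrite -(weyl_mulVK y Ww); apply: polytope_mul.
by move=> z /(polytope_mul Ww')/ymax; rewrite !dot_mul.
Qed.

Lemma face_top (F : vec -> Prop) x0 : face P F -> F x0 -> exists a, F = top a.
Proof.
move=> [a [c [Pc FE]]] Fx; exists a; apply/funext => y; apply/propext.
have [Px e] := (FE x0).1 Fx; rewrite FE; split=> [[Py ac]|[Py ymax]].
  by split=> // z /Pc; rewrite ac.
by split=> //; apply: le_anti; rewrite Pc // -e ymax.
Qed.

(** * Faces attached to a connected set of simple roots *)

Section ConnectedFaces.
Variable I : {set 'I_n}.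
Hypothesis connI : ext_connected alpha lam I.

Lemma top_osum : top (osum I) = conv (par_orbit I).
Proof. by rewrite top_dominant ?par_orbit_fixset //; apply: osum_dominant. Qed.

(** Recovers from a face, as a set, the points of [W lam] on it; [top_inj] rests on this. *)
Lemma top_orbit w x : weyl Phi w -> Worbit Phi lam x ->
  top (osum I *m w) x <-> x \in [seq y *m w | y <- olist I].
Proof.
move=> Ww Ox; rewrite top_mul //; split=> [|/mapP[y yO ->]]; last first.
  by rewrite weyl_mulK // top_osum; apply/conv_in/mem_olist.
move=> [_ /(_ _ polytope_lam) xmax]; apply/mapP; exists (x *m w^T); rewrite ?weyl_mulVK //.
have [v [Wv vE]] := worbit_mul (weyl_tr Ww) Ox.
apply/mem_olist; rewrite -par_orbit_fixset // vE.
have [|u uI ->] := dominant_max_orbit (osum_dominant I) lam_dom Wv.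
  apply: le_anti; rewrite -vE xmax andbT; apply: worbit_dot_le (osum_dominant _) _.
  by apply: worbit_mul => //; apply: weyl_tr.
by exists u.
Qed.

Lemma top_face w : weyl Phi w -> face P (top (osum I *m w)).
Proof.
move=> Ww; exists (osum I *m w), (dot (osum I) lam).
have Pmax y : P y -> dot (osum I *m w) y <= dot (osum I) lam.
  move=> /(polytope_mul (weyl_tr Ww)); rewrite dot_mul; apply: conv_dot_le => x.
  by apply: worbit_dot_le; apply: osum_dominant.
split=> // x; split=> [[Px xmax]|[Px e]]; last first.
  by split=> // z /Pmax; rewrite e.
split=> //; apply: le_anti; rewrite Pmax //=.
by rewrite -(dot_weyl (osum I) lam Ww) xmax //; apply: polytope_mul polytope_lam.
Qed.

(** The span [U] is stable under the reflections of [I], so a vector of [U] not orthogonal to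
    [alpha t] puts [alpha t] in [U]. The [t] in [I] with [alpha t] outside [U] therefore form a
    detached set. *)
Lemma olist_span i : i \in I -> alpha i \in <<[seq x - lam | x <- olist I]>>%VS.
Proof.
set U := << _ >>%VS => iI.
have scale_in c a : c != 0 -> c *: a \in U -> a \in U.
  by move=> c0 /(memvZ c^-1); rewrite scalerA mulVf // scale1r.
have olU x : x \in olist I -> x - lam \in U by move=> xI; apply: memv_span; apply: (map_f (fun x => x - lam)).
have lamU t : t \in I -> lam *m reflmx (alpha t) - lam \in U.
  move=> tI; apply: olU; apply/mem_olist; exists (reflmx (alpha t)); split=> //.
  exact: parabolic_simple.
have stU t x : t \in I -> x \in U -> x *m reflmx (alpha t) \in U.
  move=> tI /(span_mulmx (reflmx (alpha t))); apply: subvP; apply/span_subvP.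
  (* With [r] the reflection, [(y - lam) r = (y r - lam) - (lam r - lam)], and both differences are
     in [U]. *)
  move=> _ /mapP[_ /mapP[y yI ->] ->]; rewrite mulmxBl -[y *m _](subrK lam) -addrA.
  rewrite -(opprB (lam *m reflmx (alpha t))); apply: memvB; last exact: lamU.
  apply: olU; rewrite -(perm_mem (olist_map (parabolic_simple tI))).
  exact: (map_f (mulmx^~ (reflmx (alpha t)))).
have coef x t : x \in U -> x *m reflmx (alpha t) \in U -> alpha t \notin U ->
    dot x (alpha t) = 0.
  move=> xU xtU atU; have := memvB xU xtU; rewrite mul_reflmx /refl opprB addrC subrK.
  move=> cU; apply/eqP; apply: contraNT atU => d0; apply: scale_in cU.
  by rewrite !mulf_neq0 ?invr_eq0 ?pnatr_eq0 // dot_eq0 alpha_neq0.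
pose T := [set t in I | alpha t \notin U].
suff /setP/(_ i) : T = set0 by rewrite !inE iI /= => /negbFE.
apply: (connected_detached connI); first by apply/subsetP => j; rewrite inE => /andP[].
move=> t; rewrite inE => /andP[tI atU]; split.
  apply/eqP; apply: contraNT atU => d0; have := lamU t tI.
  rewrite mul_reflmx /refl addrAC subrr sub0r memvN; apply: scale_in.
  by rewrite !mulf_neq0 ?invr_eq0 ?pnatr_eq0 // dot_eq0 alpha_neq0.
move=> j; rewrite !inE => /andP[+ jI]; rewrite jI negbK /= => jU.
by rewrite dotC; apply: coef => //; apply: stU.
Qed.

(** Differences of points of the face lie in the span [V] of the [alpha i *m w], which bounds the
    dimension; by [olist_span] the moved orbit already spans [V]. *)
Lemma top_affdim w : weyl Phi w -> affdim (top (osum I *m w)) #|I|.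
Proof.
move=> Ww; pose V := <<[seq alpha i *m w | i <- enum I]>>%VS.
have dV : \dim V = #|I|.
  rewrite cardE -(size_map (fun i => alpha i *m w)); apply/eqP.
  apply: (free_dual (g := fun j => omega j *m w)); last exact: enum_uniq.
  by move=> i j; rewrite dot_weyl // dot_alpha_omega.
have topE y : top (osum I *m w) y -> conv (par_orbit I) (y *m w^T).
  by rewrite top_mul // top_osum.
have subV x y : top (osum I *m w) x -> top (osum I *m w) y -> x - y \in V.
  move=> /topE cx /topE cy.
  rewrite -(weyl_mulVK (x - y) Ww) [(x - y) *m _]simple_decomp mulmx_suml.
  apply: memv_suml => i _; rewrite -scalemxAl; have [iI|iI] := boolP (i \in I).
    by apply/memvZ/memv_span/map_f; rewrite mem_enum.
  suff -> : dot ((x - y) *m w^T) (omega i) = 0 by rewrite scale0r mem0v.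
  (* For [i] outside [I], pairing with [omega i] is constant on the hull of [W_I lam]. *)
  have om z : conv (par_orbit I) z -> dot z (omega i) = dot lam (omega i).
    move=> cz; rewrite !(dotC _ (omega i)); apply: conv_dot_eq cz => u uI.
    by rewrite !(dotC (omega i)) (par_orbit_omega uI iI).
  by rewrite mulmxBl dotBl !om ?subrr.
have upper x0 (s : seq vec) : top (osum I *m w) x0 ->
    (forall x, x \in s -> top (osum I *m w) x) ->
    free [seq x - x0 | x <- s] -> (size s <= #|I|)%N.
  move=> Fx Fs /eqP; rewrite size_map => <-; rewrite -dV; apply: dimvS.
  by apply/span_subvP => _ /mapP[x xs ->]; apply: subV => //; apply: Fs.
split=> //; pose X := [seq (x - lam) *m w | x <- olist I].
have [Y [YX fY XY]] := free_subseq X.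
have topX x : x \in olist I -> top (osum I *m w) (x *m w).
  by move=> xI; rewrite top_mul // weyl_mulK // top_osum; apply/conv_in/mem_olist.
exists (lam *m w), [seq y + lam *m w | y <- Y].
have YE : [seq x - lam *m w | x <- [seq y + lam *m w | y <- Y]] = Y.
  by rewrite -map_comp -[RHS]map_id; apply: eq_map => y /=; rewrite addrK.
have top0 : top (osum I *m w) (lam *m w) by apply/topX/olist_lam.
have topY x : x \in [seq y + lam *m w | y <- Y] -> top (osum I *m w) x.
  move=> /mapP[y /YX/mapP[z zI ->] ->]; rewrite mulmxBl subrK; exact: topX.
split=> //; last by rewrite YE.
apply/eqP; rewrite eqn_leq (upper (lam *m w)) ?YE // size_map -dV -(eqP fY).
apply: dimvS; apply: subv_trans XY; apply/span_subvP => _ /mapP[i + ->].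
rewrite mem_enum => /olist_span/(span_mulmx w); apply: subvP; apply/span_subvP.
by move=> _ /mapP[_ /mapP[x xI ->] ->]; apply/memv_span/(map_f (fun x => (x - lam) *m w)).
Qed.

End ConnectedFaces.

(** Once [a] is moved into the dominant chamber, its face is the hull of [W_K lam] with [K] the
    simple roots orthogonal to it, and the connected core of [K] has the same orbit. *)
Lemma face_osum (F : vec -> Prop) x0 : face P F -> F x0 ->
  exists I w, [/\ ext_connected alpha lam I, weyl Phi w & F = top (osum I *m w)].
Proof.
move=> fF Fx; have [a ->] := face_top fF Fx.
have [w /parabolic_weyl Ww adom] := dominant_exists setT a.
have {}adom : dominant (a *m w) by move=> i; apply: adom; rewrite inE.
have [I [IK connI orth]] := connected_core (fixset (a *m w)).
have Ww' := weyl_tr Ww.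
exists I, w^T; split=> //; apply/funext => y; apply/propext.
rewrite top_mul // top_osum // -(par_orbit_core IK orth) -top_dominant //.
by rewrite -{1}(weyl_mulK a Ww) top_mul.
Qed.

(** Equal faces contain the same orbit points, so the sums agree. Dominant representatives being
    unique, [osum I = osum I']; the orbit sizes agree too, hence so do the defects, whose supports
    are [I] and [I']. *)
Lemma top_inj I I' w w' : ext_connected alpha lam I -> ext_connected alpha lam I' ->
  weyl Phi w -> weyl Phi w' -> top (osum I *m w) = top (osum I' *m w') ->
  I = I' /\ osum I *m w = osum I' *m w'.
Proof.
move=> cI cI' Ww Ww' e.
have inW K v x : weyl Phi v -> x \in [seq y *m v | y <- olist K] -> Worbit Phi lam x.
  move=> Wv /mapP[y /mem_olist[u [Ku ->]] ->].
  exact: worbit_mul Wv (worbit_lam (parabolic_weyl Ku)).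
have pe : perm_eq [seq x *m w | x <- olist I] [seq x *m w' | x <- olist I'].
  apply: uniq_perm.
  - by rewrite map_inj_uniq ?undup_uniq //; apply: weyl_inj.
  - by rewrite map_inj_uniq ?undup_uniq //; apply: weyl_inj.
  move=> x; apply/idP/idP => xO.
    have Ox := inW _ _ _ Ww xO; apply/(top_orbit cI' Ww' Ox); rewrite -e.
    exact/(top_orbit cI Ww Ox).
  have Ox := inW _ _ _ Ww' xO; apply/(top_orbit cI Ww Ox); rewrite e.
  exact/(top_orbit cI' Ww' Ox).
have es : osum I *m w = osum I' *m w'.
  by rewrite /osum !mulmx_suml -[LHS](big_map (fun x => x *m w) predT id)
    -[RHS](big_map (fun x => x *m w') predT id) (perm_big _ pe).
split=> //; have sz : size (olist I) = size (olist I').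
  by have := perm_size pe; rewrite !size_map.
have Wv : weyl Phi (w *m w'^T) by apply: gen_by_mul => //; apply: weyl_tr.
have osE : osum I = osum I'.
  have e' : osum I *m (w *m w'^T) = osum I' by rewrite mulmxA es weyl_mulK.
  by rewrite -e' dominant_unique //; [apply: osum_dominant|rewrite e'; apply: osum_dominant].
by apply/setP => i; rewrite -!odefect_gt0 // /odefect sz osE.
Qed.

(** * Counting faces by orbits and stabilizers *)

Definition wfull := sval (cid (weyl_enum (fun w (Ww : weyl Phi w) => Ww))).

Lemma wfull_uniq : uniq wfull.
Proof. by rewrite /wfull; case: cid => l []. Qed.

Lemma mem_wfull w : w \in wfull <-> weyl Phi w.
Proof. by rewrite /wfull; case: cid => l []. Qed.

Definition orbit_list a := undup [seq a *m w | w <- wfull].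

Lemma mem_orbit_list a x : x \in orbit_list a <-> exists2 w, weyl Phi w & x = a *m w.
Proof.
rewrite mem_undup; split; first by case/mapP => w /mem_wfull; exists w.
by case=> w /mem_wfull Ww ->; apply: map_f.
Qed.

(** The elements sending [a] to a given [a *m v] form a coset of the stabilizer, which is [W_K] for
    [K = fixset a]. *)
Lemma orbit_stabilizer a : dominant a ->
  size wfull = (size (orbit_list a) * size (wlist (fixset a)))%N.
Proof.
move=> da; have fiber x : x \in orbit_list a ->
    count (fun w => a *m w == x) wfull = size (wlist (fixset a)).
  move=> /mem_orbit_list[v Wv ->]; rewrite -size_filter -[RHS](size_map (mulmx^~ v)).
  apply: perm_size; apply: uniq_perm; first by rewrite filter_uniq ?wfull_uniq.
    rewrite map_inj_uniq ?wlist_uniq // => w w' /(congr1 (mulmx^~ v^T)) /=.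
    by rewrite -!mulmxA weyl_orth // !mulmx1.
  move=> w; rewrite mem_filter; apply/andP/mapP => [[/eqP av /mem_wfull Ww]|[u]].
    exists (w *m v^T); last by rewrite -mulmxA weyl_orthC // mulmx1.
    apply/mem_wlist/dominant_stab => //; first by apply: gen_by_mul => //; apply: weyl_tr.
    by rewrite mulmxA av weyl_mulK.
  move=> /mem_wlist au ->; have Wu := parabolic_weyl au.
  have /(dominant_stab da Wu) aE := au.
  by rewrite mulmxA aE; split=> //; apply/mem_wfull/gen_by_mul.
transitivity (\sum_(x <- orbit_list a) count (fun w => a *m w == x) wfull)%N; last first.
  rewrite big_seq (eq_bigr _ fiber) -big_seq big_const_seq count_predT iter_addn_0.
  by rewrite mulnC.
under eq_bigr => x _ do rewrite -sum1_count big_mkcond.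
rewrite exchange_big /= -sum1_size big_seq [RHS]big_seq; apply: eq_bigr => w wW.
rewrite -big_mkcond sum1_count (@eq_count _ _ (pred1 (a *m w))); last first.
  by move=> x; rewrite /= eq_sym.
by rewrite count_uniq_mem ?undup_uniq // mem_undup map_f.
Qed.

(** Faces of dimension [k] are indexed by the pairs in [L]: [face_osum] shows that all of them
    occur, [top_inj] that none is repeated. *)
Lemma fcountE k : fcount P k =
  (\sum_(I : {set 'I_n} | ext_connected alpha lam I && (#|I| == k))
    size (orbit_list (osum I)))%N.
Proof.
pose A := [pred I : {set 'I_n} | ext_connected alpha lam I && (#|I| == k)].
pose L := [seq (K, x) | K <- enum A, x <- orbit_list (osum K)].
have memL I x : (I, x) \in L ->
    [/\ ext_connected alpha lam I, #|I| = k & exists2 w, weyl Phi w & x = osum I *m w].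
  move=> /allpairsPdep[J [y [+ + [-> ->]]]]; rewrite mem_enum => /andP[cJ /eqP Jk].
  by move=> /mem_orbit_list.
rewrite (_ : (\sum_(I | _) _)%N = size (map (fun p => top p.2) L)); last first.
  by rewrite size_map size_allpairs_dep sumnE big_map big_enum; apply: eq_bigl => K; rewrite inE.
apply: ncardE.
  apply: NoDup_map_in.
    apply: allpairs_uniq_dep; rewrite ?enum_uniq //.
      by move=> I _; apply: undup_uniq.
    by move=> [I x] [J y] _ _ /= [-> ->].
  move=> [I x] [J y] /memL[cI _ [w Ww ->]] /memL[cJ _ [v Wv ->]] /= e.
  by have [-> ->] := top_inj cI cJ Ww Wv e.
move=> F; split.
  move=> /List.in_map_iff[[I x] [<- /InP/memL[cI <- [w Ww ->]]]] /=.
  by split; [apply: top_face|apply: top_affdim].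
move=> [fF [[x0 [s [Fx Fs sk fs]]] maxF]].
have [I [w [cI Ww FE]]] := face_osum fF Fx.
have [[y0 [t [Fy Ft tk ft]]] maxI] := top_affdim cI Ww.
rewrite -FE in Fy Ft maxI.
(* Both dimension statements concern the same face, so each maximality clause bounds the size of the
   other's free family. *)
have Ik : #|I| = k.
  apply/eqP; rewrite eqn_leq -{1}tk (maxF y0 t) // -sk (maxI x0 s) //.
apply/List.in_map_iff; exists (I, osum I *m w); split=> //; apply/InP.
apply/allpairsPdep; exists I, (osum I *m w); split=> //.
  by rewrite mem_enum inE cI Ik eqxx.
by apply/mem_orbit_list; exists w.
Qed.

Lemma fcount_parabolic k : (fcount P k)%:R =
  \sum_(I : {set 'I_n} | ext_connected alpha lam I && (#|I| == k))
     ((ncard (weyl Phi))%:R / (ncard (parabolic alpha (Istar alpha lam I)))%:R : R).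
Proof.
rewrite fcountE natr_sum; apply: eq_bigr => I /andP[cI _].
rewrite (ncard_uniq wfull_uniq mem_wfull) (orbit_stabilizer (osum_dominant I)).
rewrite fixset_osum // (ncard_uniq (wlist_uniq _) (@mem_wlist _)) natrM mulfK //.
rewrite pnatr_eq0 -lt0n; have : 1%:M \in wlist (Istar alpha lam I).
  by apply/mem_wlist; apply: gen_one.
by case: wlist.
Qed.

End Roots.

(* Coefficient of t^k in the f-polynomial of P = conv(W lam), for every k. *)
Theorem theorem4p16 (R : realType) (n : nat) (Phi : seq 'rV[R]_n)
    (alpha : 'I_n -> 'rV[R]_n) (lam : 'rV[R]_n) :
  root_system Phi -> irreducible Phi -> is_base Phi alpha ->
  dominant_integral alpha lam ->
  forall k : nat,
    (fcount (conv (Worbit Phi lam)) k)%:R =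
    \sum_(I : {set 'I_n} | ext_connected alpha lam I && (#|I| == k))
       ((ncard (weyl Phi))%:R / (ncard (parabolic alpha (Istar alpha lam I)))%:R : R).
Proof.
move=> HPhi _ Hbase lamint k; apply: fcount_parabolic => // i.
(* Dominance in the sense of [dominant] follows because [2 / dot (alpha i) (alpha i)] is
   positive. *)
have a_gt0 : 0 < dot (alpha i) (alpha i) by apply/dot_gt0/(alpha_neq0 HPhi Hbase).
have := natr_ge0 (lamint i); rewrite pmulr_lge0 ?invr_gt0 //.
by rewrite pmulr_rge0.
Qed.
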